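(* Let $G$ be a finite group with derived subgroup $G'$, and let $t$ be a positive integer. Then $$ \sum_{g\in G'}\left|P_t^{G}(g)-\frac{1}{|G'|}\right| \leq \left(\frac{|G'|}{|G|}\sum_{\chi\in\mathrm{Irr}(G),\ \chi(1)\neq 1}\chi(1)^{-2t}\right)^{1/2}. $$
   Context: $\mathrm{Irr}(G)$ denotes the set of irreducible complex characters of $G$. For a positive integer $t$, $c_t:G^{2t}\to G$ is the word map $c_t=[x_1,y_1]\cdots[x_t,y_t]$. For $g\in G$, $N_t^G(g)$ is the number of $2t$-tuples in $G^{2t}$ mapped to $g$ by $c_t$, and $P_t^G(g)=N_t^G(g)/|G|^{2t}$. *)

(* Defs.v *)
From mathcomp Require Import all_boot all_order all_algebra all_fingroup.
From mathcomp Require Import all_solvable all_field all_character.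

Set Implicit Arguments.
Unset Strict Implicit.
Unset Printing Implicit Defensive.

Import GroupScope GRing.Theory Num.Theory.
Local Open Scope ring_scope.

(* The 2t-tuple w is read as (x_1, y_1, ..., x_t, y_t), so that x_(i+1) and
   y_(i+1) sit at positions 2i and 2i+1; these are always in range, hence the
   default value of nth plays no role. The product is ordered, and
   [~ x, y] = x^-1 * y^-1 * x * y. *)
Definition comm_word (gT : finGroupType) (t : nat) (w : (2 * t).-tuple gT) : gT :=
  (\prod_(i < t) [~ nth 1 w (2 * i), nth 1 w (2 * i + 1)])%g.

Definition comm_count (gT : finGroupType) (G : {group gT}) (t : nat) (g : gT) : nat :=
  #|[set w : (2 * t).-tuple gT | all (mem G) w & comm_word w == g]|.

Definition comm_prob (gT : finGroupType) (G : {group gT}) (t : nat) (g : gT) : algC :=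
  (comm_count G t g)%:R / #|G|%:R ^+ (2 * t).

(* Main.v *)
Require Import Defs.
From mathcomp Require Import all_boot all_order all_algebra all_fingroup.
From mathcomp Require Import all_solvable all_field all_character.
From mathcomp Require Import ring.

Set Implicit Arguments.
Unset Strict Implicit.
Unset Printing Implicit Defensive.

(** The proof is Fourier analysis on the class functions of G, followed by the
    Cauchy-Schwarz inequality.

    Schur's lemma makes the average of 'chi_i over the products of a conjugate
    of a with b equal to 'chi_i a * 'chi_i b / 'chi_i 1 ([irr_sum_conj]).  Since
    [~ x, y] is x^-1 times a conjugate of x, averaging over y and then over x
    shows that inserting one random commutator in the argument of 'chi_i divides
    its mean value by 'chi_i 1 ^+ 2 ([irr_sum_commg]), so that t of them divide
    it by 'chi_i 1 ^+ (2 * t) ([irr_sum_comm_word]).  Detecting the equation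
    comm_word w = g with the regular character then yields the formula of
    Frobenius
      P_t(g) = 1/|G| * \sum_i 'chi_i 1 ^ (1 - 2t) * 'chi_i g^-1
    ([comm_probE]).

    On G' every linear character takes the value 1, and there are |G : G'| of
    them; their contribution to the formula is therefore exactly 1/|G'|, the
    uniform distribution, and the deviation from uniform is the sum over the
    nonlinear characters alone ([comm_prob_sub_uniform]).  By Cauchy-Schwarz on
    G', and after enlarging the sum of squares from G' to G, the square of the
    L^1 deviation is at most |G'| * |G| times the norm of that class function,
    which orthonormality of the irreducible characters evaluates.  This gives
    |G'|/|G| * \sum 'chi_i 1 ^ (2 - 4t), and 2 - 4t <= - 2t because t > 0. *)

Import GroupScope Order.POrderTheory GRing.Theory Num.Theory.
Local Open Scope ring_scope.

(** The Cauchy-Schwarz inequality against the constant function 1. *)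
Lemma sqr_sum_le (R : numFieldType) (I : finType) (A : {pred I}) (f : I -> R) :
    {in A, forall x, f x \is Num.real} ->
  (\sum_(x in A) f x) ^+ 2 <= #|A|%:R * \sum_(x in A) f x ^+ 2.
Proof.
move=> f_real; set S := \sum_(x in A) f x; set Q := \sum_(x in A) _.
have [A0 | A_gt0] := posnP #|A|.
  rewrite A0 mul0r /S big_pred0 ?expr0n //.
  by move=> x; rewrite (card0_eq A0).
have S_real : S \is Num.real by apply: rpred_sum.
suff: 0 <= #|A|%:R * (#|A|%:R * Q - S ^+ 2).
  by rewrite pmulr_rge0 ?ltr0n // subr_ge0.
(* The left side is the sum of the squares of the deviations from the mean,
   scaled so as to avoid a division. *)
have <- : \sum_(x in A) (#|A|%:R * f x - S) ^+ 2
          = #|A|%:R * (#|A|%:R * Q - S ^+ 2).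
  transitivity (\sum_(x in A)
      (#|A|%:R ^+ 2 * f x ^+ 2 + (- 2 * #|A|%:R * S) * f x + S ^+ 2)).
    by apply: eq_bigr => x _; ring.
  by rewrite !big_split /= -!mulr_sumr -/S -/Q sumr_const; ring.
apply: sumr_ge0 => x xA; rewrite real_exprn_even_ge0 //.
by rewrite rpredB ?rpredM ?f_real ?realn.
Qed.

Section CharacterSums.

Variables (gT : finGroupType) (G : {group gT}) (i : Iirr G).

(** The sum of all a ^ y is central in the group ring, so by Schur's lemma an
    irreducible representation affording 'chi_i maps it to a scalar, and taking
    traces identifies this scalar as #|G| * 'chi_i a / 'chi_i 1. *)
Lemma irr_sum_conj a b : a \in G -> b \in G ->
  \sum_(y in G) 'chi_i (a ^ y * b)%g = #|G|%:R * 'chi_i a * 'chi_i b / 'chi_i 1%g.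
Proof.
move=> Ga Gb; have chi1_neq0 := irr1_neq0 i.
have /irr_reprP[[n rG] /= irr_rG chiE] := mem_irr i.
rewrite chiE in chi1_neq0 *.
pose M := \sum_(y in G) rG (a ^ y)%g.
have [c Mc] : exists c, M = c%:M.
  apply/is_scalar_mxP; apply: (mx_abs_irr_cent_scalar (groupC irr_rG)).
  apply/centgmxP => x Gx; rewrite mulmx_suml mulmx_sumr.
  rewrite [RHS](reindex_inj (mulIg x)) /=.
  apply: eq_big => [y | y Gy]; first by rewrite groupMr.
  rewrite -!repr_mxM ?groupJ ?groupM //.
  by rewrite conjgM -conjgC.
have trM : \tr M = #|G|%:R * cfRepr rG a.
  rewrite raddf_sum -sum1_card natr_sum mulr_suml; apply: eq_bigr => y Gy.
  by rewrite mul1r -(cfunJ (cfRepr rG) a Gy) cfunE groupJ.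
have -> : \sum_(y in G) cfRepr rG (a ^ y * b)%g = c * cfRepr rG b.
  transitivity (\tr (M *m rG b)).
    rewrite mulmx_suml raddf_sum; apply: eq_bigr => y Gy.
    by rewrite cfunE groupM ?groupJ // repr_mxM ?groupJ.
  by rewrite Mc mul_scalar_mx mxtraceZ cfunE Gb.
rewrite -trM Mc mxtrace_scalar -[c *+ n]mulr_natr -(cfRepr1 rG).
by field.
Qed.

(** The convolution square of 'chi_i: a form of the generalized orthogonality
    relation in which the inverse sits inside the shifted argument. *)
Lemma irr_sum_mul g : g \in G ->
  \sum_(x in G) 'chi_i x * 'chi_i (g * x^-1)%g = #|G|%:R * 'chi_i g / 'chi_i 1%g.
Proof.
move=> Gg; have := generalized_orthogonality_relation g i i.
rewrite eqxx mul1r => /(canRL (mulVKf (neq0CG G))).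
rewrite mulrA => <-; rewrite (reindex_inj invg_inj) /=.
apply: eq_big => [x | x _]; first by rewrite groupV.
by rewrite invgK mulrC -(cfunJ _ (g * x)%g Gg) conjgE mulgA mulKg.
Qed.

(** As [~ x, y] = x^-1 * x ^ y, the sum over y is a conjugation average, and the
    sum over x that remains is a convolution of 'chi_i with itself. *)
Lemma irr_sum_commg g : g \in G ->
  \sum_(x in G) \sum_(y in G) 'chi_i ([~ x, y] * g)%g
    = #|G|%:R ^+ 2 * 'chi_i g / 'chi_i 1%g ^+ 2.
Proof.
move=> Gg.
transitivity (\sum_(x in G)
    #|G|%:R / 'chi_i 1%g * ('chi_i x * 'chi_i (g * x^-1)%g)).
  apply: eq_bigr => x Gx; have Gx' : x^-1%g \in G by rewrite groupV.
  have <- : #|G|%:R * 'chi_i x * 'chi_i (g * x^-1)%g / 'chi_i 1%g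
          = #|G|%:R / 'chi_i 1%g * ('chi_i x * 'chi_i (g * x^-1)%g).
    by field; apply: irr1_neq0.
  rewrite -irr_sum_conj ?groupM //; apply: eq_bigr => y _.
  (* Conjugating by x^-1 moves the leading factor x^-1 to the far right. *)
  rewrite -(cfunJ _ ([~ x, y] * g)%g Gx'); congr ('chi_i _).
  by rewrite [LHS]conjgE invgK commgEl -!mulgA mulKVg.
by rewrite -mulr_sumr irr_sum_mul //; field; exact: irr1_neq0.
Qed.

End CharacterSums.

Lemma sum_tuple_cons (R : nmodType) (T : finType) (P : pred T) (n : nat)
    (F : seq T -> R) :
  \sum_(w : n.+1.-tuple T | all P w) F w
    = \sum_(x | P x) \sum_(w : n.-tuple T | all P w) F (x :: w).
Proof.
rewrite pair_big_dep /=.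
rewrite (reindex (fun p : T * n.-tuple T => [tuple of p.1 :: p.2])) //=.
exists (fun w => (thead w, [tuple of behead w])) => [[x w] _ | w _] /=.
  by congr (_, _); apply: val_inj.
by rewrite [RHS](tuple_eta w).
Qed.

(** Peeling off the first commutator of the word, the other commutators and g
    play the role of the fixed factor in [irr_sum_commg]. *)
Lemma irr_sum_comm_word (gT : finGroupType) (G : {group gT}) (i : Iirr G)
    (t : nat) (g : gT) : g \in G ->
  \sum_(w : (2 * t).-tuple gT | all (mem G) w) 'chi_i (comm_word w * g)%g
    = #|G|%:R ^+ (2 * t) * 'chi_i g / 'chi_i 1%g ^+ (2 * t).
Proof.
(* Words are read off plain sequences, so that the induction on t does not have
   to transport tuples along 2 * t.+1 = (2 * t).+2. *)
move=> Gg; pose c t (s : seq gT) :=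
  (\prod_(j < t) [~ nth 1 s (2 * j), nth 1 s (2 * j + 1)])%g.
have cS u x y s : c u.+1 [:: x, y & s] = ([~ x, y] * c u s)%g.
  rewrite /c big_ord_recl; congr (_ * _)%g; apply: eq_bigr => j _.
  by rewrite lift0 mulnS add2n.
have Gc u s : all (mem G) s -> c u s \in G.
  move=> /allP Gs; have Gnth k : nth 1%g s k \in G.
    have [lt_k | le_k] := ltnP k (size s); first exact/Gs/mem_nth.
    by rewrite nth_default.
  by apply: group_prod => j _; apply: groupR; apply: Gnth.
rewrite -[LHS]/(\sum_(w : (2 * t).-tuple gT | all (mem G) w) 'chi_i (c t w * g)%g).
have chi1_neq0 := irr1_neq0 i.
elim: t => [|t IHt].
  rewrite muln0 !expr0 mul1r divr1 (big_pred1 [tuple]) => [|w]; last first.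
    by rewrite tuple0 /= eqxx.
  by rewrite /c big_ord0 mul1g.
rewrite mulnS add2n (sum_tuple_cons _ _ (fun s => 'chi_i (c t.+1 s * g)%g)).
under eq_bigr => x _ do
  rewrite (sum_tuple_cons _ _ (fun s => 'chi_i (c t.+1 (x :: s) * g)%g)) exchange_big.
rewrite exchange_big /=.
under eq_bigr => w Gw.
  under eq_bigr => x _ do under eq_bigr => y _ do rewrite cS -mulgA.
  rewrite irr_sum_commg ?groupM ?Gc //.
  over.
rewrite -mulr_suml -mulr_sumr IHt -add2n !(exprD _ 2 (2 * t)); field.
by rewrite expf_neq0.
Qed.

(** The formula of Frobenius: the regular character tests whether
    comm_word w * g^-1 is trivial, and it is the sum of the 'chi_i weighted by
    their degrees. *)
Lemma comm_probE (gT : finGroupType) (G : {group gT}) (t : nat) (g : gT) :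
    g \in G ->
  comm_prob G t g
    = #|G|%:R^-1 * \sum_i 'chi[G]_i 1%g / 'chi_i 1%g ^+ (2 * t) * 'chi_i g^-1%g.
Proof.
move=> Gg; have G_neq0 : #|G|%:R != 0 :> algC := neq0CG G.
have countE : (comm_count G t g)%:R * #|G|%:R
    = \sum_(w : (2 * t).-tuple gT | all (mem G) w)
        cfReg G (comm_word w * g^-1)%g.
  rewrite /comm_count -sum1_card natr_sum mulr_suml.
  under eq_bigl => w do rewrite inE.
  rewrite big_mkcondr /=; apply: eq_bigr => w _.
  by rewrite cfRegE -eq_mulgV1; case: eqP; rewrite ?mul1r.
rewrite /comm_prob; apply: (canLR (mulfK _)); first exact: expf_neq0.
apply: (mulIf G_neq0); rewrite countE cfReg_sum.
under eq_bigr => w _ do rewrite sum_cfunE.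
rewrite exchange_big /= mulr_sumr !mulr_suml; apply: eq_bigr => i _.
under eq_bigr => w _ do rewrite cfunE.
rewrite -mulr_sumr irr_sum_comm_word ?groupV //; field.
by rewrite G_neq0 expf_neq0 ?irr1_neq0.
Qed.

(** The part of the formula of Frobenius carried by the nonlinear characters,
    with g^-1 renamed to g so as to be an explicit combination of the 'chi_i;
    sums of norms over a subgroup are invariant under this inversion. *)
Definition nonlinear_part (gT : finGroupType) (G : {group gT}) (t : nat) :
    'CF(G) :=
  \sum_(i | 'chi[G]_i 1%g != 1)
    ('chi_i 1%g / 'chi_i 1%g ^+ (2 * t) / #|G|%:R) *: 'chi_i.

(** The linear characters are trivial on the derived subgroup and their number
    is its index, so together they account for the uniform distribution. *)
Lemma comm_prob_sub_uniform (gT : finGroupType) (G : {group gT}) (t : nat)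
    (g : gT) : g \in G^`(1)%g ->
  comm_prob G t g - #|G^`(1)%g|%:R^-1 = nonlinear_part G t g^-1%g.
Proof.
move=> G'g; have sG'G := der_sub 1 G; have Gg := subsetP sG'G g G'g.
have linE i : ('chi[G]_i 1%g == 1) = ('chi_i \is a linear_char).
  by rewrite qualifE /= irr_char.
rewrite comm_probE // (bigID (fun i => 'chi[G]_i 1%g == 1)) /= mulrDr addrC.
have -> : \sum_(i | 'chi[G]_i 1%g == 1)
            'chi_i 1%g / 'chi_i 1%g ^+ (2 * t) * 'chi_i g^-1%g
        = #|G : G^`(1)%g|%:R.
  rewrite -card_lin_irr -sum1_card natr_sum.
  apply: eq_big => [i | i chi1]; first by rewrite linE.
  have lin_i : 'chi_i \is a linear_char by rewrite -linE.
  rewrite (eqP chi1) expr1n divr1 mul1r cfker1 ?(eqP chi1) //.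
  by rewrite groupV (subsetP (lin_char_der1 lin_i)).
rewrite -(Lagrange sG'G) natrM invfM.
rewrite -[_^-1 * _ * _]mulrA mulVf ?mulr1; last first.
  by rewrite pnatr_eq0 -lt0n indexg_gt0.
rewrite -invfM -natrM Lagrange // sum_cfunE mulr_sumr addKr; apply: eq_bigr => i _.
by rewrite cfunE mulrC mulrAC.
Qed.

Lemma cfnorm_nonlinear_part (gT : finGroupType) (G : {group gT}) (t : nat) :
  '[nonlinear_part G t]
    = \sum_(i | 'chi[G]_i 1%g != 1)
        ('chi_i 1%g / 'chi_i 1%g ^+ (2 * t) / #|G|%:R) ^+ 2.
Proof.
rewrite cfdot_suml; apply: eq_bigr => i nl_i.
rewrite cfdotZl cfdot_sumr (bigD1 i) //= big1 => [|j /andP[_ ne_ji]].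
  rewrite addr0 cfdotZr cfnorm_irr mulr1 expr2; congr (_ * _).
  have chi1_real : 'chi_i 1%g \is Num.real by rewrite gtr0_real ?irr1_gt0.
  by apply: conj_Creal; rewrite !rpred_div ?rpredX ?realn.
by rewrite cfdotZr cfdot_irr eq_sym (negbTE ne_ji) mulr0.
Qed.

Theorem proposition1p2 (gT : finGroupType) (G : {group gT}) (t : nat)
    (ht : (0 < t)%N) :
  \sum_(g in G^`(1)%g) `|comm_prob G t g - #|G^`(1)%g|%:R^-1|
  <= sqrtC (#|G^`(1)%g|%:R / #|G|%:R
            * \sum_(chi <- irr G | chi 1%g != 1) chi 1%g ^- (2 * t)).
Proof.
have G_gt0 : 0 < #|G|%:R :> algC := gt0CG G.
rewrite big_tuple; set d := nonlinear_part G t.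
have -> : \sum_(g in G^`(1)%g) `|comm_prob G t g - #|G^`(1)%g|%:R^-1|
        = \sum_(g in G^`(1)%g) `|d g|.
  rewrite [RHS](reindex_inj invg_inj) /=.
  apply: eq_big => [g | g G'g]; first by rewrite groupV.
  by rewrite comm_prob_sub_uniform.
have sum_ge0 : 0 <= \sum_(g in G^`(1)%g) `|d g| by apply: sumr_ge0.
rewrite -(sqrCK sum_ge0) ler_sqrtC ?qualifE /= ?exprn_ge0 //; last first.
  rewrite mulr_ge0 ?divr_ge0 ?ler0n ?sumr_ge0 // => i _.
  by rewrite invr_ge0 exprn_ge0 // ltW ?irr1_gt0.
apply: (le_trans (sqr_sum_le _)) => [g _|]; first exact: normr_real.
rewrite -mulrA ler_wpM2l ?ler0n //.
apply: (@le_trans _ _ (\sum_(g in G) `|d g| ^+ 2)).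
  rewrite [leRHS](big_setID G^`(1)%g) /= (setIidPr (der_sub 1 G)) lerDl.
  by apply: sumr_ge0 => g _; rewrite exprn_ge0.
have -> : \sum_(g in G) `|d g| ^+ 2 = #|G|%:R * '[d].
  by rewrite (cfnormE (cfun_onG d)) mulrA divff ?mul1r // neq0CG.
rewrite cfnorm_nonlinear_part !mulr_sumr; apply: ler_sum => i _.
(* It remains to compare exponents, one character at a time; this is where
   t > 0 is needed. *)
set x := 'chi_i 1%g; have x_gt0 : 0 < x := irr1_gt0 i.
have x_ge1 : 1 <= x by rewrite /x irr1_degree ler1n irr_degree_gt0.
have -> : #|G|%:R * (x / x ^+ (2 * t) / #|G|%:R) ^+ 2
        = #|G|%:R^-1 * (x ^- (2 * t) * (x ^+ 2 / x ^+ (2 * t))).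
  by field; rewrite expf_neq0 ?gt_eqF.
rewrite ler_pM2l ?invr_gt0 //.
apply: ler_piMr; first by rewrite invr_ge0 exprn_ge0 ?ltW.
by rewrite ler_pdivrMr ?exprn_gt0 // mul1r ler_weXn2l // leq_pmulr.
Qed.
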